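(* Let $G=\mathbb{Z}_{N_1}\oplus\cdots\oplus\mathbb{Z}_{N_k}$ be a finite Abelian group (each $N_j$ a prime power), let $K\le G$ and let $f:G\to G$ satisfy $f(x)=f(y)\iff x-y\in K$. Let $0<\epsilon<1$ and run the following procedure with $h$ iterations: in each iteration $i=1,\dots,h$ (independently), prepare $|0\rangle\cdots|0\rangle|0_G\rangle\in\mathcal{H}_{N_1}\otimes\cdots\otimes\mathcal{H}_{N_k}\otimes\mathcal{H}_G$, apply $\mathrm{QFT}_{N_1}\otimes\cdots\otimes\mathrm{QFT}_{N_k}\otimes \mathrm{I}_G$, then $U_f$, then $\mathrm{QFT}_{N_1}^\dagger\otimes\cdots\otimes\mathrm{QFT}_{N_k}^\dagger\otimes \mathrm{I}_G$, and measure the first $k$ registers in the computational basis, obtaining $\mathbf{t}_i\in G$. Let $T_h=\{\mathbf{t}_1,\dots,\mathbf{t}_h\}$ and output $A=\{x\in G:\langle \mathbf{t}_i,x\rangle=0 \text{ for all } i\}=(\mathrm{span}(T_h))^{\perp}$. Then $\Pr(A=K)\ge 1-\epsilon$ provided \[ h\ \ge\ \mathrm{rank}(G)+\left\lceil \log_2 \tfrac{2}{\epsilon}\right\rceil \quad\text{or}\quad h\ \ge\ \mathrm{len}(G)-\mathrm{len}(K)+\left\lceil \log_2 \tfrac{1}{\epsilon}\right\rceil. \]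
   Context: Elements of $G$ are tuples $x=(x_1,\dots,x_k)$ with $x_j\in\{0,\dots,N_j-1\}$. The bilinear form is $\langle x,y\rangle=\sum_{j=1}^k x_jy_j/N_j \pmod 1\in\mathbb{R}/\mathbb{Z}$, and for $H\le G$, $H^\perp=\{g\in G:\langle h,g\rangle=0 \ \forall h\in H\}$; $\mathrm{span}(T)$ is the subgroup generated by $T$. $\mathrm{rank}(G)$ is the minimal size of a generating set of $G$; $\mathrm{len}(G)$ is the length of a composition series of $G$ (for $|G|=\prod p_i^{e_i}$ this is $\sum e_i$). $\mathcal{H}_{N}$ is the $N$-dimensional Hilbert space with orthonormal basis $\{|x\rangle:x\in\mathbb{Z}_N\}$, $\mathcal{H}_G=\bigotimes_j\mathcal{H}_{N_j}$ with basis $\{|g\rangle: g\in G\}$, $\mathrm{I}_G$ its identity, and $\mathrm{QFT}_N|x\rangle=\frac{1}{\sqrt N}\sum_{y=0}^{N-1}e^{2\pi i xy/N}|y\rangle$. The oracle $U_f$ acts on $\mathcal{H}_G\otimes\mathcal{H}_G$ by $U_f|g\rangle|b\rangle=|g\rangle|b+f(g)\rangle$ (addition in $G$); $0_G$ is the zero of $G$. *)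

(* Defs.v *)
(* with MathComp-Analysis (reals, cos/sin/pi/ln) and
   mathcomp-real-closed's complex numbers R[i]. *)
From HB Require Import structures.
From mathcomp Require Import all_boot all_order all_algebra.
From mathcomp Require Import all_classical all_reals all_analysis.
From mathcomp Require Import complex.
Set Implicit Arguments. Unset Strict Implicit. Unset Printing Implicit Defensive.
Import Order.TTheory GRing.Theory Num.Theory.
Local Open Scope ring_scope.

Section Group.
Variables (k : nat) (N : 'I_k -> nat).

(* G = Z_{N_1} (+) ... (+) Z_{N_k}: tuples x with x_j in {0,..,N_j-1}. *)
Definition grp : finType := {dffun forall j : 'I_k, 'I_(N j)}.

Lemma ord_pos n (x : 'I_n) : (0 < n)%N.
Proof. by apply: leq_ltn_trans (ltn_ord x). Qed.

Definition ordmod n (x : 'I_n) (m : nat) : 'I_n :=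
  Ordinal (ltn_pmod m (ord_pos x)).

(* group operations of G (componentwise mod N_j) *)
Definition addG (x y : grp) : grp :=
  [ffun j => ordmod (x j) (x j + y j)%N].
Definition oppG (x : grp) : grp :=
  [ffun j => ordmod (x j) (N j - x j)%N].
Definition subG (x y : grp) : grp := addG x (oppG y).
(* x is the zero 0_G of G *)
Definition is_zeroG (x : grp) : bool := [forall j, nat_of_ord (x j) == 0%N].

(* H <= G : H is a subgroup of G *)
Definition is_subgroup (H : {set grp}) : bool :=
  [&& [exists x in H, is_zeroG x],
      [forall x in H, forall y in H, addG x y \in H] &
      [forall x in H, oppG x \in H]].

(* span(T): the subgroup generated by T (intersection of all subgroups
   containing T) *)
Definition span (T : {set grp}) : {set grp} :=
  [set x | [forall S : {set grp}, (is_subgroup S && (T \subset S)) ==> (x \in S)]].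

(* rank(G): minimal size of a generating set of G *)
Definition rankG : nat :=
  \big[minn/#|grp|]_(T : {set grp} | span T == [set: grp]) #|T|.

(* len of a finite group of order n = prod p_i^e_i : sum of the e_i *)
Definition len_of_order (n : nat) : nat :=
  \sum_(p < n.+1 | prime p) logn p n.

(* <x,y> = sum_j x_j y_j / N_j  (as a rational) ; <x,y> = 0 in R/Z iff it is
   an integer *)
Definition pairing (x y : grp) : rat :=
  \sum_(j < k) ((nat_of_ord (x j) * nat_of_ord (y j))%:R / (N j)%:R).
Definition pairing_zero (x y : grp) : bool := pairing x y \is a Num.int.

(* H^perp *)
Definition perp (H : {set grp}) : {set grp} :=
  [set g | [forall h in H, pairing_zero h g]].

Section Quantum.
Variable R : realType.
Local Open Scope complex_scope.

(* e^{i theta} *)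
Definition expi (theta : R) : R[i] := cos theta +i* sin theta.

(* matrix entry <y| QFT_n |x> = e^{2 pi i x y / n} / sqrt n *)
Definition qft_entry (n x y : nat) : R[i] :=
  expi (2 * pi * (x * y)%:R / n%:R) * ((Num.sqrt (n%:R : R))^-1)%:C.

(* states of H_G (x) H_G, as amplitude functions on the basis |g>|b> *)
Definition state := grp -> grp -> R[i].

(* |0>...|0>|0_G> *)
Definition init_state : state :=
  fun g b => if is_zeroG g && is_zeroG b then 1 else 0.

(* QFT_{N_1} (x) ... (x) QFT_{N_k} (x) I_G *)
Definition QFT_I (psi : state) : state :=
  fun y b => \sum_(x : grp)
     (\prod_(j < k) qft_entry (N j) (x j) (y j)) * psi x b.

(* QFT_{N_1}^dagger (x) ... (x) QFT_{N_k}^dagger (x) I_G ; the adjoint has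
   entries <y|Q^dagger|x> = conj <x|Q|y> *)
Definition QFTdag_I (psi : state) : state :=
  fun y b => \sum_(x : grp)
     (\prod_(j < k) (qft_entry (N j) (y j) (x j))^*) * psi x b.

(* U_f |g>|b> = |g>|b + f(g)> *)
Definition Uf (f : grp -> grp) (psi : state) : state :=
  fun g b => psi g (subG b (f g)).

Definition sqnorm (z : R[i]) : R := (complex.Re z) ^+ 2 + (complex.Im z) ^+ 2.

(* probability of outcome t when measuring the first k registers *)
Definition meas_prob (f : grp -> grp) (t : grp) : R :=
  \sum_(b : grp) sqnorm (QFTdag_I (Uf f (QFT_I init_state)) t b).

(* output of the procedure from the measured outcomes t_1..t_h *)
Definition output (h : nat) (ts : {ffun 'I_h -> grp}) : {set grp} :=
  [set x | [forall i, pairing_zero (ts i) x]].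

(* Pr(A = K) over h independent iterations *)
Definition prob_success (f : grp -> grp) (h : nat) (K : {set grp}) : R :=
  \sum_(ts : {ffun 'I_h -> grp})
     (\prod_(i < h) meas_prob f (ts i)) * (output ts == K)%:R.
End Quantum.
End Group.

(* Main.v *)
(* Writing each squared amplitude as a double sum and using orthogonality of
   characters, one iteration returns a uniform element of [K^perp].  If the
   outcomes lie in [K^perp] but [A <> K], then by Cauchy's theorem [A / K] has an
   element [y] of some prime order [p], and every outcome lies in [B^perp], where
   [B] is the preimage of [<y>], with [|B| = p |K|].  Since [|H| |H^perp| = |G|],
   this has probability [p^-h].  There are at most [p^r] elements of order [p] in
   [G / K], [r] being its [p]-rank, so the failure probability is at most the sum
   of [p^(r - h)] over the primes dividing [|G / K|].  Bounding [r] by [rank G]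
   leaves [2^-c * sum (2/p)^c <= 2 * 2^-c] for [c >= 2]; bounding it by
   [len(G/K) - (w - 1)], with [w] the number of these primes, leaves
   [w * 2^-(c + w - 1) <= 2^-c]. *)
Require Import Defs.
From HB Require Import structures.
From mathcomp Require Import all_boot all_order all_algebra.
From mathcomp Require Import all_fingroup all_solvable.
From mathcomp Require Import all_classical all_reals all_analysis.
From mathcomp Require Import complex.
From mathcomp Require Import ring lra zify.
Set Implicit Arguments. Unset Strict Implicit. Unset Printing Implicit Defensive.
Import Order.TTheory GRing.Theory Num.Theory.
Local Open Scope ring_scope.

(** * The exponential on the unit circle *)

Section CircleCharacter.
Variable R : realType.

Lemma expi0 : expi 0 = 1 :> R[i].
Proof. by rewrite /expi cos0 sin0. Qed.

Lemma expiD (a b : R) : expi (a + b) = expi a * expi b.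
Proof. by rewrite /expi cosD sinD; simpc; congr (Complex _ _); rewrite addrC. Qed.

Lemma expi_conj (a : R) : (expi a)^* = expi (- a).
Proof. by rewrite /expi cosN sinN. Qed.

Lemma expi_mul_conj (a : R) : expi a * (expi a)^* = 1.
Proof. by rewrite expi_conj -expiD subrr expi0. Qed.

Lemma expi_2pi_nat (n : nat) : expi (2 * pi * n%:R) = 1 :> R[i].
Proof.
elim: n => [|n IHn]; first by rewrite mulr0 expi0.
rewrite -[n.+1]addn1 natrD mulrDr expiD IHn mul1r mulr1 /expi mulrC mulr_natr.
by rewrite cos2pi sin2pi.
Qed.

Lemma expi_2pi_int (z : int) : expi (2 * pi * z%:~R) = 1 :> R[i].
Proof.
case: (intP z) => [|n|n]; first by rewrite mulr0 expi0.
  by rewrite expi_2pi_nat.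
by rewrite mulrNz mulrN -expi_conj expi_2pi_nat rmorph1.
Qed.

(** After subtracting the floor, a remainder strictly between 0 and 1 would make [sin (pi * r)]
    positive, while [cos (2 * pi * r) = 1] forces it to vanish. *)
Lemma expi_2pi_eq1 (q : rat) : expi (2 * pi * ratr q) = 1 :> R[i] <-> q \is a Num.int.
Proof.
split=> [|/intrP[z ->]]; last by rewrite ratr_int expi_2pi_int.
set z := Num.floor q; set r := q - z%:~R.
have /andP[r_ge0 r_lt1] : 0 <= r < 1.
  by have := floor_itv q; rewrite -/z intrD subr_ge0 ltrBlDl.
rewrite -[q](subrK z%:~R) -/r raddfD /= ratr_int mulrDr expiD expi_2pi_int mulr1.
have [-> _|r_neq0] := eqVneq r 0; first by rewrite add0r intr_int.
have r_gt0 : 0 < r by rewrite lt_def r_neq0.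
move=> /(congr1 (@complex.Re R)) /=.
have -> : 2 * pi * ratr r = (pi * ratr r : R) *+ 2 by rewrite -[RHS]mulr_natl mulrA.
rewrite cos_mulr2n => cos1.
have : 0 < sin (pi * ratr r : R).
  apply: sin_gt0_pi; rewrite mulr_gt0 ?pi_gt0 ?ltr0q //=.
  by rewrite gtr_pMr ?pi_gt0 // -(rmorph1 (@ratr R)) ltr_rat.
have := cos2Dsin2 (pi * ratr r : R); nra.
Qed.

End CircleCharacter.

(** * The tuples as a finite abelian group *)

Section TupleGroup.
Variables (k : nat) (N : 'I_k -> nat).

Lemma addGE (x y : grp N) j : (addG x y j : nat) = ((x j + y j) %% N j)%N.
Proof. by rewrite ffunE. Qed.

Lemma oppGE (x : grp N) j : (oppG x j : nat) = ((N j - x j) %% N j)%N.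
Proof. by rewrite ffunE. Qed.

Lemma grpP (x y : grp N) : (forall j, x j = y j :> nat) -> x = y.
Proof. by move=> eq_xy; apply/ffunP=> j; apply/val_inj/eq_xy. Qed.

Lemma addGA : associative (@addG k N).
Proof. by move=> x y z; apply: grpP => j; rewrite !addGE modnDml modnDmr addnA. Qed.

Lemma addGC : commutative (@addG k N).
Proof. by move=> x y; apply: grpP => j; rewrite !addGE addnC. Qed.

Variable Npos : forall j, (0 < N j)%N.

Definition zeroG : grp N := [ffun j => Ordinal (Npos j)].

Lemma is_zeroGE (x : grp N) : is_zeroG x = (x == zeroG).
Proof.
apply/forallP/eqP => [x0|-> j]; last by rewrite ffunE.
by apply: grpP => j; rewrite ffunE; apply/eqP/x0.
Qed.

Lemma add0G : left_id zeroG (@addG k N).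
Proof. by move=> x; apply: grpP => j; rewrite addGE ffunE /= add0n modn_small. Qed.

Lemma addNG : left_inverse zeroG (@oppG k N) (@addG k N).
Proof.
move=> x; apply: grpP => j.
by rewrite addGE oppGE modnDml subnK ?modnn ?ffunE // ltnW.
Qed.

(* [grp N] has a zero only when every modulus is positive, so the group
   structure is put on an alias that carries the positivity proof. *)
Definition tupgroup : Type := let _ := Npos in grp N.
HB.instance Definition _ := Finite.on tupgroup.
HB.instance Definition _ := Finite_isGroup.Build tupgroup addGA add0G addNG.

Lemma tupgroup_abelian (H : {set tupgroup}) : abelian H.
Proof. by apply/centsP => x _ y _; apply: addGC. Qed.

Lemma subGE (x y : tupgroup) : subG x y = (x * y^-1)%g.
Proof. by []. Qed.

Lemma is_subgroup_group_set (H : {set grp N}) : is_subgroup H -> group_set (H : {set tupgroup}).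
Proof.
case/and3P=> /exists_inP[x Hx]; rewrite is_zeroGE => /eqP x0.
move=> /forall_inP HD _; apply/group_setP; split; first by rewrite x0 in Hx.
by move=> y z Hy Hz; have /forall_inP := HD y Hy; apply.
Qed.

Lemma group_is_subgroup (H : {group tupgroup}) : is_subgroup (H : {set grp N}).
Proof.
apply/and3P; split.
- by apply/exists_inP; exists zeroG; [exact: (group1 H) | rewrite is_zeroGE].
- by apply/forall_inP=> x Hx; apply/forall_inP=> y Hy; exact: (@groupM _ H x y).
- by apply/forall_inP=> x Hx; exact: (@groupVr _ H x).
Qed.

Lemma mem_span_gen (T : {set grp N}) (x : grp N) :
  x \in Defs.span T -> (x : tupgroup) \in <<(T : {set tupgroup})>>%g.
Proof.
rewrite inE => /forallP/(_ <<(T : {set tupgroup})>>%g)/implyP; apply.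
by rewrite group_is_subgroup; exact: (@subset_gen _ (T : {set tupgroup})).
Qed.

(** For an abelian group, ['r] equals the least number of generators ['m]. The default [#|grp|] of
    the minimum is harmless, since the whole group generates itself. *)
Lemma rank_le_rankG : ('r([set: tupgroup])%g <= rankG N)%N.
Proof.
have grank_gen (B : {set tupgroup}) :
  <<B>>%g = [set: tupgroup] -> ('m([set: tupgroup])%g <= #|B|)%N.
- by move=> <-; exact: grank_min.
rewrite -grank_abelian ?tupgroup_abelian // /rankG.
elim/big_ind: _ => [|a b le_a le_b|T /eqP spanT].
- apply: leq_trans (grank_gen [set: tupgroup] _) (max_card _).
  exact: (@gen_set_id _ [set: tupgroup] (groupP [set: tupgroup]%G)).
- by rewrite leq_min le_a.
apply: (grank_gen T); apply/setP=> x; rewrite finset.in_setT.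
by apply: mem_span_gen; rewrite spanT finset.in_setT.
Qed.
End TupleGroup.

(** * Characters, orthogonality and annihilators *)

Section Characters.
Variables (R : realType) (k : nat) (N : 'I_k -> nat).
Hypothesis Npos : forall j, (0 < N j)%N.
Implicit Types x y t : grp N.

Definition chi x t : R[i] :=
  \prod_(j < k) expi (2 * pi * (x j * t j)%:R / (N j)%:R).

Lemma chiC x t : chi x t = chi t x.
Proof. by apply: eq_bigr => j _; rewrite mulnC. Qed.

Lemma chiD x y t : chi (addG x y) t = chi x t * chi y t.
Proof.
rewrite -big_split; apply: eq_bigr => j _ /=; rewrite addGE.
set a : nat := x j; set b : nat := y j; set c : nat := t j.
have N_neq0 : (N j)%:R != 0 :> R by rewrite pnatr_eq0 -lt0n.
(* Reducing modulo [N j] changes the angle by an integer multiple of [2 * pi]. *)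
have -> : 2 * pi * (((a + b) %% N j)%N * c)%:R / (N j)%:R =
    2 * pi * ((a + b) * c)%:R / (N j)%:R - 2 * pi * ((a + b) %/ N j * c)%:R :> R.
  by rewrite {2}(divn_eq (a + b) (N j)) !(natrD, natrM); field.
rewrite expiD -[expi (- _)]expi_conj expi_2pi_nat rmorph1 mulr1 -expiD.
by congr expi; rewrite !(natrD, natrM); field.
Qed.

Lemma chi_expi x t : chi x t = expi (2 * pi * ratr (pairing x t)).
Proof.
rewrite /pairing raddf_sum mulr_sumr (big_morph (@expi R) (@expiD R) (@expi0 R)).
by apply: eq_bigr => j _ /=; rewrite fmorph_div !rmorph_nat mulrA.
Qed.

Lemma chi_eq1 x t : (chi x t == 1) = pairing_zero x t.
Proof.
rewrite chi_expi /pairing_zero; apply/eqP/idP => [e1|q_int].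
  exact/(expi_2pi_eq1 R).
exact/expi_2pi_eq1.
Qed.

Lemma pairing_zeroC x t : pairing_zero x t = pairing_zero t x.
Proof.
by congr (_ \is a _); apply: eq_bigr => j _; rewrite mulnC.
Qed.

Lemma chiK x t : chi x t * (chi x t)^* = 1.
Proof. by rewrite chi_expi expi_mul_conj. Qed.

Lemma chi0 t : chi (zeroG Npos) t = 1.
Proof. by rewrite /chi big1 // => j _; rewrite ffunE /= mulr0 mul0r expi0. Qed.

Lemma perpP (H : {set grp N}) t :
  reflect (forall h, h \in H -> chi h t = 1) (t \in perp H).
Proof.
rewrite inE; apply: (iffP forall_inP) => Ht h /Ht; first by rewrite -chi_eq1 => /eqP.
by rewrite -chi_eq1 => /eqP.
Qed.

(* A character nontrivial on [H] is multiplied by a value other than [1] when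
   [H] is translated, so its sum over [H] vanishes. *)
Lemma sum_chi (H : {group tupgroup Npos}) t :
  \sum_(h in H) chi h t = (#|H| * (t \in perp (H : {set grp N})))%:R.
Proof.
case: (perpP (H : {set grp N}) t) => [Ht | nHt].
  by rewrite (eq_bigr (fun=> 1)) // sumr_const muln1.
have /forall_inPn[h0 Hh0 chi1] : ~~ [forall h in (H : {set grp N}), chi h t == 1].
  by apply/negP=> /forall_inP Ht; apply: nHt => h /Ht /eqP.
set S := \sum_(h in H) _; rewrite muln0; apply/eqP.
have : chi h0 t * S = S.
  rewrite /S mulr_sumr [RHS](reindex_inj (@mulgI _ (h0 : tupgroup Npos))) /=.
  by apply: eq_big => [h|h Hh]; rewrite ?groupMl // -chiD.
move/eqP; rewrite -subr_eq0 -{2}[S]mul1r -mulrBl mulf_eq0 subr_eq0.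
by rewrite (negPf chi1).
Qed.

(** Nondegeneracy of the pairing: a nonzero coordinate of [t] is detected by the corresponding unit
    vector. *)
Lemma perp_setT : perp [set: grp N] = [set zeroG Npos].
Proof.
apply/setP=> t; rewrite finset.in_set1; apply/idP/eqP => [/perpP Ht | ->]; last first.
  by apply/perpP=> h _; rewrite chiC chi0.
apply: grpP => j; have ->: zeroG Npos j = 0%N :> nat by rewrite ffunE.
apply/eqP; rewrite eqn0Ngt; apply/negP=> tj_gt0.
have N_gt1 : (1 < N j)%N by apply: leq_ltn_trans tj_gt0 (ltn_ord _).
(* The [j]-th unit vector; [t i] only witnesses that ['I_(N i)] is inhabited. The pairing with [t]
   is [t j / N j], strictly between 0 and 1. *)
pose u : grp N := [ffun i => ordmod (t i) (i == j)].
have /eqP := Ht u (finset.in_setT u); rewrite chi_eq1 /pairing_zero /pairing.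
rewrite (bigD1 j) //= big1 => [|i /negPf ij]; last by rewrite ffunE ij /= mod0n mul0n mul0r.
rewrite ffunE eqxx /= modn_small // mul1n addr0.
have N_gt0 : 0 < (N j)%:R :> rat by rewrite ltr0n.
move=> /intrP[z Ez].
have : 0 < z%:~R :> rat by rewrite -Ez divr_gt0 ?ltr0n.
have : z%:~R < 1 :> rat by rewrite -Ez ltr_pdivrMr // mul1r ltr_nat.
by rewrite ltr0z ltrz1; lia.
Qed.

(** Double counting of the sum of [chi h t] over [t] in the group and [h] in [H]: summing over [h]
    first leaves [t] in [perp H], summing over [t] first leaves only [h = 0]. *)
Lemma card_perp (H : {group tupgroup Npos}) :
  (#|H| * #|perp (H : {set grp N})| = #|grp N|)%N.
Proof.
apply/eqP; rewrite -(eqr_nat R[i]); apply/eqP.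
have <- : \sum_(t : tupgroup Npos) \sum_(h in H) chi h t = (#|H| * #|perp (H : {set grp N})|)%:R.
  rewrite (eq_bigr _ (fun t _ => sum_chi H t)) -natr_sum -big_distrr /=.
  congr (_ * _)%:R; rewrite -sum1_card [RHS]big_mkcond /=.
  by apply: eq_bigr => t _; case: (_ \in _).
rewrite exchange_big /= (bigD1 1%g) ?group1 //= [X in X + _](eq_bigr (fun=> 1)); last first.
  by move=> t _; exact: chi0.
rewrite sumr_const big1 ?addr0 // => h /andP[_ h_neq1].
rewrite (eq_bigr (fun t => chi t h)) => [|t _]; last exact: chiC.
have := sum_chi [set: tupgroup Npos]%G h; rewrite perp_setT finset.in_set1 (negPf h_neq1) muln0.
rewrite mulr0n => sum0; rewrite -[RHS]sum0.
by apply: eq_bigl => t; rewrite finset.in_setT.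
Qed.
End Characters.

(** * Outcome distribution of one iteration *)

Section Measurement.
Variables (R : realType) (k : nat) (N : 'I_k -> nat).
Hypothesis Npos : forall j, (0 < N j)%N.
Implicit Types x y t b : grp N.

Definition qft_scale : R[i] := \prod_(j < k) real_complex R (Num.sqrt (N j)%:R)^-1.

Lemma qft_scale_sqr : qft_scale * qft_scale = #|grp N|%:R^-1.
Proof.
rewrite -big_split /= card_dep_ffun foldrE big_map big_enum /= natr_prod -prodfV; apply: eq_bigr => j _.
rewrite -rmorphM -invfM -expr2 sqr_sqrtr ?ler0n // fmorphV rmorph_nat.
by rewrite card_ord.
Qed.

Lemma prod_qft_entry x y :
  \prod_(j < k) qft_entry R (N j) (x j) (y j) = chi R x y * qft_scale.
Proof. by rewrite -big_split. Qed.

Lemma prod_qft_entry_conj x y :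
  \prod_(j < k) (qft_entry R (N j) (x j) (y j))^* = (chi R x y)^* * qft_scale.
Proof.
rewrite -rmorph_prod prod_qft_entry rmorphM /=; congr (_ * _).
by rewrite rmorph_prod; apply: eq_bigr => j _; apply: conjc_real.
Qed.

Lemma QFT_I_init y b : QFT_I (@init_state k N R) y b = qft_scale * (is_zeroG b)%:R.
Proof.
rewrite /QFT_I (bigD1 (zeroG Npos)) //= [X in _ + X]big1 => [|x /negPf x_neq0]; last first.
  by rewrite /init_state (is_zeroGE Npos x) x_neq0 mulr0.
rewrite prod_qft_entry chi0 mul1r addr0 /init_state (is_zeroGE Npos (zeroG Npos)) eqxx.
by case: is_zeroG.
Qed.

Lemma subG_is_zero b x : is_zeroG (subG b x) = (b == x).
Proof.
rewrite (is_zeroGE Npos); apply/eqP/eqP => [|->].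
  exact: (@divg1_eq (tupgroup Npos)).
exact: (@mulgV (tupgroup Npos)).
Qed.

Lemma sqnormE (z : R[i]) : real_complex R (sqnorm z) = z * z^*.
Proof. by rewrite -sqr_normc -add_Re2_Im2. Qed.

Section Oracle.
Variables (K : {group tupgroup Npos}) (f : grp N -> grp N).
Hypothesis fK : forall x y, f x = f y <-> subG x y \in (K : {set grp N}).

(** The first transform gives a uniform superposition and the oracle keeps the [x] with [f x = b];
    the two factors [qft_scale] multiply to the inverse of the group order. *)
Lemma amplitudeE t b :
  QFTdag_I (Uf f (QFT_I (@init_state k N R))) t b =
  #|grp N|%:R^-1 * \sum_(x | f x == b) (chi R x t)^*.
Proof.
rewrite /QFTdag_I /Uf mulr_sumr [RHS]big_mkcond; apply: eq_bigr => x _ /=.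
rewrite prod_qft_entry_conj QFT_I_init subG_is_zero eq_sym chiC.
case: eqP => _; last by rewrite !mulr0.
by rewrite mulr1 -mulrA qft_scale_sqr mulrC.
Qed.

(* Expanding the squared amplitudes turns the sum over [b] into a sum over
   the pairs [x, x + h] with [h] in [K]. *)
Lemma meas_probE t :
  meas_prob R f t = #|K|%:R / #|grp N|%:R * (t \in perp (K : {set grp N}))%:R.
Proof.
apply: complexI; rewrite rmorph_sum /=.
pose c : R[i] := #|grp N|%:R^-1.
transitivity (c * c * \sum_x \sum_(y | f y == f x) (chi R x t)^* * chi R y t).
  rewrite [in RHS](partition_big f xpredT) //= mulr_sumr; apply: eq_bigr => b _.
  rewrite sqnormE amplitudeE rmorphM rmorph_sum /= mulrACA.
  have -> : c^* = c by rewrite fmorphV rmorph_nat.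
  congr (_ * _); rewrite mulr_suml; apply: eq_bigr => x /eqP ->.
  by rewrite mulr_sumr; apply: eq_bigr => y _; rewrite conjCK.
have inner x : \sum_(y | f y == f x) (chi R x t)^* * chi R y t =
    (#|K| * (t \in perp (K : {set grp N})))%:R.
  rewrite -sum_chi (reindex_inj (@mulIg _ (x : tupgroup Npos))) /=.
  apply: eq_big => [h|h _].
    apply/eqP/idP => [/fK|Kh]; last apply/fK; 
      by rewrite (subGE (h * x : tupgroup Npos)%g x) mulgK.
  by rewrite (chiD _ Npos) mulrCA [_^* * _]mulrC chiK mulr1.
rewrite (eq_bigr _ (fun x _ => inner x)) sumr_const -[_ *+ _]mulr_natr natrM.
rewrite rmorphM [X in _ = X * _]rmorphM fmorphV !rmorph_nat.
have G_neq0 : #|grp N|%:R != 0 :> R[i].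
  by rewrite pnatr_eq0 -lt0n; apply/card_gt0P; exists (zeroG Npos).
rewrite -[#|xpredT|]/(#|grp N|) -[#|{dffun _}|]/(#|grp N|) /c.
by field.
Qed.
End Oracle.
End Measurement.

(** * Union bound on the failure probability *)

Section Failure.
Variables (R : realType) (k : nat) (N : 'I_k -> nat).
Hypothesis Npos : forall j, (0 < N j)%N.
Let gT := tupgroup Npos.

Lemma tupgroup_normal (H : {group gT}) : (normal H [set: gT]).
Proof. by rewrite -sub_abelian_normal ?subsetT ?tupgroup_abelian. Qed.

Lemma output_group_set h (ts : {ffun 'I_h -> grp N}) :
  group_set (output ts : {set gT}).
Proof.
apply/group_setP; split=> [|x y]; rewrite ?finset.inE.
  by apply/forallP=> i; rewrite -(chi_eq1 R) chiC; apply/eqP/chi0.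
move=> /forallP zx /forallP zy; apply/forallP=> i.
rewrite -(chi_eq1 R) chiC (chiD R Npos) ![chi R _ (ts i)]chiC.
by move: (zx i) (zy i); rewrite -!(chi_eq1 R) => /eqP-> /eqP->; rewrite mulr1.
Qed.

(** The Galois connection of the pairing, by its symmetry. *)
Lemma mem_perp_output h (ts : {ffun 'I_h -> grp N}) (H : {set grp N}) :
  (forall i, ts i \in perp H) <-> H \subset output ts.
Proof.
split=> [tsH|/fintype.subsetP Hts i].
  apply/fintype.subsetP=> x Hx; rewrite inE; apply/forallP=> i.
  by have := tsH i; rewrite inE pairing_zeroC => /forall_inP; apply.
rewrite inE; apply/forall_inP=> x /Hts; rewrite inE pairing_zeroC => /forallP; exact.
Qed.

Section Oracle.
Variables (K : {group gT}) (f : grp N -> grp N).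
Hypothesis fK : forall x y, f x = f y <-> subG x y \in (K : {set grp N}).
Let G : {group gT} := [set: gT]%G.
Let prob := meas_prob R f.

Lemma meas_prob_ge0 t : 0 <= prob t.
Proof. by rewrite /prob (meas_probE R fK) mulr_ge0 ?divr_ge0 ?ler0n. Qed.

(** As [perp B] lies in [perp K], every term is [#|K| / #|G|], and [card_perp] counts the terms. *)
Lemma meas_prob_perp (B : {group gT}) : K \subset B ->
  \sum_(t | t \in perp (B : {set grp N})) prob t = #|K|%:R / #|B|%:R.
Proof.
move=> sKB; rewrite (eq_bigr (fun=> #|K|%:R / #|grp N|%:R)) => [|t /(perpP R) tB].
  rewrite sumr_const -(card_perp R B) natrM invfM -[_ *+ _]mulr_natr -!mulrA.
  by rewrite mulVf ?mulr1 // pnatr_eq0 -lt0n; apply/card_gt0P; exists (zeroG Npos);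
     apply/(perpP R) => h _; rewrite chiC chi0.
rewrite /prob (meas_probE R fK); suff -> : t \in perp (K : {set grp N}) by rewrite mulr1.
by apply/(perpP R)=> x Kx; apply: tB; apply: (fintype.subsetP sKB).
Qed.

Lemma sum_meas_prob : \sum_t prob t = 1.
Proof.
rewrite (bigID (fun t => t \in perp (K : {set grp N}))) /= meas_prob_perp //.
rewrite big1 ?addr0 => [|t /negPf tK]; last by rewrite /prob (meas_probE R fK) tK mulr0.
by rewrite divff // pnatr_eq0 -lt0n cardG_gt0.
Qed.

(** Independence: with the indicator inside each factor, the sum over all outcome tuples factors
    over the iterations. *)
Lemma sum_prod_meas_prob h (A : pred (grp N)) :
  \sum_(ts : {ffun 'I_h -> grp N}) \prod_i (prob (ts i) * (A (ts i))%:R) =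
  (\sum_(t | A t) prob t) ^+ h.
Proof.
rewrite -(bigA_distr_bigA (fun (i : 'I_h) t => prob t * (A t)%:R)) prodr_const card_ord.
congr (_ ^+ _); rewrite [RHS]big_mkcond; apply: eq_bigr => t _.
by case: (A t); rewrite (mulr1, mulr0).
Qed.

(* If all outcomes lie in [perp K] but [A] strictly contains [K], then by Cauchy's
   theorem some [y] of prime order in [A / K] lifts to a subgroup of [A]. *)
Lemma output_failure h (ts : {ffun 'I_h -> grp N}) :
  (forall i, ts i \in perp (K : {set grp N})) -> output ts != K ->
  exists y, [/\ y \in (G / K)%g, prime #[y]%g &
    forall i, ts i \in perp ((coset K @*^-1 <[y]>)%g : {set grp N})].
Proof.
move=> /mem_perp_output sKA A_neqK.
pose A : {group gT} := Group (output_group_set ts).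
have nKA : A \subset 'N(K)%g by apply: fintype.subset_trans (finset.subsetT _) (normal_norm (tupgroup_normal K)).
have AK_gt1 : (1 < #|(A / K)%g|)%N.
  rewrite cardG_gt1 -subG1 quotient_sub1 //; apply: contra A_neqK => sAK.
  by rewrite finset.eqEsubset sAK.
have [y Ay oy] := Cauchy (pdiv_prime AK_gt1) (pdiv_dvd _).
exists y; split; first by apply: (fintype.subsetP (quotientS K (finset.subsetT A))).
  by rewrite oy pdiv_prime.
apply/mem_perp_output; have sub_A : (coset K @*^-1 <[y]> \subset A)%g.
  by rewrite -(@quotientGK _ K A) ?cosetpreSK ?cycle_subG //= /normal sKA.
exact: sub_A.
Qed.

Lemma prob_failure_le h :
  1 - prob_success R f h K <=
  \sum_(y in (G / K)%g | prime #[y]%g) (#[y]%g%:R : R) ^- h.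
Proof.
pose B (y : coset_of K) := (coset K @*^-1 <[y]>)%G.
have total : 1 = \sum_(ts : {ffun 'I_h -> grp N}) \prod_i prob (ts i).
  transitivity ((\sum_t prob t) ^+ h); first by rewrite sum_meas_prob expr1n.
  rewrite -[LHS](sum_prod_meas_prob h predT).
  by apply: eq_bigr => ts _; apply: eq_bigr => i _; rewrite mulr1.
rewrite {1}total /prob_success -sumrB.
(* The bound holds tuple by tuple: a tuple with an outcome outside [perp K] has probability 0, a
   successful one contributes nothing on the left, and a failing one is covered by the [y] of
   [output_failure]. *)
apply: (@le_trans _ _ (\sum_(ts : {ffun 'I_h -> grp N}) \sum_(y in (G / K)%g | prime #[y]%g)
   \prod_i (prob (ts i) * (ts i \in perp (B y : {set grp N}))%:R))).
  apply: ler_sum => ts _; pose P := \prod_i prob (ts i).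
  rewrite -[\prod_(i < h) prob (ts i)]/P.
  have prod_ge0 (A : pred (grp N)) : 0 <= \prod_i (prob (ts i) * (A (ts i))%:R).
    by apply: prodr_ge0 => i _; rewrite mulr_ge0 ?meas_prob_ge0.
  have [tsK|/forallPn[i /negPf tsiK]] := boolP [forall i, ts i \in perp (K : {set grp N})]; last first.
    have -> : P = 0 by rewrite /P (bigD1 i) //= /prob (meas_probE R fK) tsiK mulr0 mul0r.
    rewrite mul0r subrr.
    by apply: sumr_ge0 => y _; exact: (prod_ge0 (mem (perp (B y : {set grp N})))).
  have [_|/(output_failure (forallP tsK))[y [Gy y_pr tsB]]] := eqVneq (output ts) (K : {set grp N}).
    rewrite mulr1 subrr.
    by apply: sumr_ge0 => y _; exact: (prod_ge0 (mem (perp (B y : {set grp N})))).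
  rewrite mulr0 subr0 (bigD1 y) ?Gy //= -[X in X <= _]addr0 lerD //.
    by apply: ler_prod => i _; rewrite meas_prob_ge0 tsB mulr1 /=.
  by apply: sumr_ge0 => z _; exact: (prod_ge0 (mem (perp (B z : {set grp N})))).
rewrite exchange_big /=; apply: ler_sum => y /andP[Gy _].
rewrite (sum_prod_meas_prob h (mem (perp (B y : {set grp N})))).
(* The preimage [B y] has order [#|K| * #[y]], so one iteration lands in its annihilator with
   probability [1 / #[y]]. *)
rewrite (@meas_prob_perp (B y)) ?sub_cosetpre // card_cosetpre natrM invfM mulrA divff.
  by rewrite mul1r exprVn.
by rewrite pnatr_eq0 -lt0n cardG_gt0.
Qed.
End Oracle.
End Failure.

(** * Counting elements of prime order *)

Section GroupCount.
Variables (gT : finGroupType) (Q : {group gT}).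
Hypothesis abelQ : abelian Q.

(** In an abelian group the solutions of [y ^ p = 1] form an elementary abelian subgroup, whose rank
    is at most the [p]-rank. *)
Lemma card_order_prime_le p : prime p ->
  (#|[set y in Q | #[y]%g == p]| <= p ^ 'r_p(Q)%g)%N.
Proof.
move=> p_pr; pose E := Group (group_Ldiv p abelQ).
have sEQ : E \subset Q by apply: finset.subsetIl.
have abelemE : (p.-abelem E)%g.
  apply/abelemP=> //; split; first exact: abelianS abelQ.
  by move=> x /LdivP[].
apply: (@leq_trans #|E|).
  apply/subset_leq_card/fintype.subsetP=> y; rewrite finset.inE => /andP[Qy /eqP oy].
  by apply/LdivP; rewrite Qy -oy expg_order.
rewrite (card_pgroup (abelem_pgroup abelemE)) leq_exp2l ?prime_gt1 //.
by apply: logn_le_p_rank; apply/pElemP.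
Qed.

Lemma sum_order_prime_le (R : realType) h :
  \sum_(y in Q | prime #[y]%g) (#[y]%g%:R : R) ^- h <=
  \sum_(p < #|Q|.+1 | (p : nat) \in primes #|Q|) (p%:R : R) ^+ 'r_p(Q)%g / p%:R ^+ h.
Proof.
(* The order as an element of a finite type, to partition the sum by it; the default of [inord]
   never occurs on [Q]. *)
pose o (y : gT) : 'I_#|Q|.+1 := inord #[y]%g.
have oE y : y \in Q -> o y = #[y]%g :> nat.
  by move=> Qy; rewrite inordK // ltnS dvdn_leq ?cardG_gt0 ?order_dvdG.
rewrite (partition_big o (fun p => (p : nat) \in primes #|Q|)) /=; last first.
  by move=> y /andP[Qy y_pr]; rewrite oE // mem_primes y_pr cardG_gt0 order_dvdG.
apply: ler_sum => p; rewrite mem_primes => /and3P[p_pr _ _].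
rewrite (eq_bigr (fun=> (p%:R : R) ^- h)) => [|y /andP[/andP[Qy _] /eqP <-]]; last by rewrite oE.
rewrite sumr_const -[_ *+ _]mulr_natl ler_wpM2r ?invr_ge0 ?exprn_ge0 //.
rewrite -natrX ler_nat; apply: leq_trans (card_order_prime_le p_pr).
apply/subset_leq_card/fintype.subsetP=> y /andP[/andP[Qy _] /eqP op].
by rewrite finset.inE Qy -op oE /=.
Qed.
End GroupCount.

(** * Composition length as a function of the order *)

Lemma len_of_orderE n m : (n < m)%N ->
  len_of_order n = (\sum_(p < m | prime p) logn p n)%N.
Proof.
move=> lt_nm; rewrite /len_of_order.
rewrite -!(big_mkord (fun p => prime p) (fun p => logn p n)).
rewrite (big_cat_nat (n := n.+1) (p := m)) //= [X in (_ + X)%N]big_nat_cond [X in (_ + X)%N]big1 ?addn0 //.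
by move=> p /andP[/andP[lt_np _] _]; rewrite ltn_log0.
Qed.

Lemma len_of_orderM a b : (0 < a)%N -> (0 < b)%N ->
  len_of_order (a * b) = (len_of_order a + len_of_order b)%N.
Proof.
move=> a_gt0 b_gt0.
rewrite !(@len_of_orderE _ (a * b).+1) ?ltnS ?leq_pmulr ?leq_pmull // -big_split.
by apply: eq_bigr => p _; rewrite lognM.
Qed.

(** Each prime divisor other than [p] adds at least one to the length; the successor accounts for
    [p] itself among the primes counted. *)
Lemma logn_card_primes_le n p : p \in primes n ->
  (logn p n + #|[pred q : 'I_n.+1 | (q : nat) \in primes n]| <= (len_of_order n).+1)%N.
Proof.
move=> pn; have n_gt0 : (0 < n)%N by move: pn; rewrite mem_primes => /and3P[].
have lt_pn : (p < n.+1)%N.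
  by rewrite ltnS dvdn_leq //; move: pn; rewrite mem_primes => /and3P[].
pose i : 'I_n.+1 := Ordinal lt_pn.
have primes_len : len_of_order n = (\sum_(q < n.+1 | (q : nat) \in primes n) logn q n)%N.
  rewrite /len_of_order big_mkcond [RHS]big_mkcond; apply: eq_bigr => q _.
  rewrite mem_primes n_gt0 /=; case: (boolP (prime q)) => //= q_pr.
  by case: (boolP (q %| n)%N) => // nqn; rewrite lognE (negPf nqn) !andbF.
rewrite primes_len -sum1_card (bigD1 i) //= [X in (_ <= X.+1)%N](bigD1 i) //= addnCA add1n ltnS.
by rewrite leq_add2l; apply: leq_sum => q /andP[qn _]; rewrite logn_gt0.
Qed.

(** * Estimates for the sums over primes *)

Section Numeric.
Variable R : realType.

Lemma expr_div_le (x : R) r h c : 1 <= x -> (c + r <= h)%N -> x ^+ r / x ^+ h <= x ^- c.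
Proof.
move=> x_ge1 r_h; have x_gt0 : 0 < x by apply: lt_le_trans x_ge1.
rewrite ler_pdivrMr ?exprn_gt0 // ler_pdivlMl ?exprn_gt0 // -exprD.
exact: ler_weXn2l.
Qed.

Lemma sum_exp_len_le n (r : nat -> nat) c h :
  (forall p, r p <= logn p n)%N -> (len_of_order n + c <= h)%N ->
  \sum_(p < n.+1 | (p : nat) \in primes n) (p%:R : R) ^+ r p / p%:R ^+ h <= 2 ^- c.
Proof.
move=> r_le h_ge; set w := #|[pred q : 'I_n.+1 | (q : nat) \in primes n]|.
apply: (@le_trans _ _ (\sum_(p < n.+1 | (p : nat) \in primes n) (2 : R) ^- (c + w.-1))).
  apply: ler_sum => p pn; have p_pr : prime p by move: pn; rewrite mem_primes => /and3P[].
  have := logn_card_primes_le pn; rewrite -/w => rw.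
  have w_gt0 : (0 < w)%N by apply/card_gt0P; exists p.
  have r_h : (c + w.-1 + r p <= h)%N by have := r_le p; lia.
  apply: le_trans (expr_div_le _ r_h) _; first by rewrite ler1n prime_gt0.
  rewrite lef_pV2 ?posrE ?exprn_gt0 ?ltr0n ?prime_gt0 // lerXn2r ?nnegrE ?ler0n //.
  by rewrite ler_nat prime_gt1.
rewrite sumr_const -/w exprD invfM -[_ *+ w]mulr_natr -mulrA ger_pMr ?invr_gt0 ?exprn_gt0 //.
rewrite mulrC ler_pdivrMr ?exprn_gt0 // mul1r -natrX ler_nat.
(* This is [w <= 2 ^ w.-1], where [w = 0] is the case of an empty sum. *)
by case: (w) => [|m] //=; apply: ltn_expl.
Qed.

(* Beyond [p = 2], the primes are odd and [4 / (2 m + 1) ^ 2 <= 1 / m - 1 / (m + 1)]. *)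
Lemma sum_inv_prime_sqr_le n : \sum_(p < n | prime p) (2 / p%:R : R) ^+ 2 <= 2.
Proof.
(* The range starts with the single prime 2, contributing [1 = 2 - 1]. Each step adds the odd
   [2 m + 3] and the even [2 m + 4], which is not prime. *)
have odd_bound m : \sum_(0 <= p < m.*2.+3 | prime p) (2 / p%:R : R) ^+ 2 <= 2 - m.+1%:R^-1.
  elim: m => [|m IHm].
    by rewrite big_mkcond !big_nat_recr //= big_geq //= !add0r divff // expr1n invr1; lra.
  rewrite doubleS big_mkcond big_nat_recr // big_nat_recr //= -big_mkcond /=.
  have -> : prime m.*2.+4 = false.
    by apply/negP=> /even_prime[//|]; rewrite /= odd_double.
  rewrite addr0; apply: (@le_trans _ _ (2 - m.+1%:R^-1 + (2 / m.*2.+3%:R) ^+ 2)).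
    by apply: lerD => //; case: ifP => // _; rewrite sqr_ge0.
  have -> : m.*2.+3%:R = 2 * m.+1%:R + 1 :> R by rewrite -mul2n -!natr1 natrM; ring.
  have -> : m.+2%:R = m.+1%:R + 1 :> R by rewrite -!natr1.
  have x_gt0 : 0 < m.+1%:R :> R by rewrite ltr0n.
  set x := m.+1%:R in x_gt0 *.
  have -> : (2 / (2 * x + 1)) ^+ 2 = 4 / (2 * x + 1) ^+ 2 :> R by field; lra.
  have : 4 / (2 * x + 1) ^+ 2 <= x^-1 - (x + 1)^-1.
    (* The remainder comes from [(2 x + 1) ^ 2 - 4 x (x + 1) = 1]. *)
    have -> : x^-1 - (x + 1)^-1 = 4 / (2 * x + 1) ^+ 2 + (x * (x + 1) * (2 * x + 1) ^+ 2)^-1.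
      by field; lra.
    rewrite lerDl invr_ge0 mulr_ge0 ?sqr_ge0 // mulr_ge0 //; lra.
  by move: (4 / _) (x^-1) ((x + 1)^-1) => a u v; lra.
have [m n_le] : exists m, (n <= m.*2.+3)%N by exists n; lia.
rewrite -(big_mkord (fun p => prime p) (fun p => (2 / p%:R : R) ^+ 2)).
apply: (@le_trans _ _ (2 - m.+1%:R^-1)); last by rewrite lerBlDr lerDl invr_ge0 ler0n.
apply: le_trans (odd_bound m); rewrite [X in _ <= X](big_cat_nat (n := n)) //= lerDl.
by apply: sumr_ge0 => p _; rewrite sqr_ge0.
Qed.

(** Once [2 ^- c] is factored out, [2 / p <= 1] and [c >= 2] bound [(2 / p) ^ c] by [(2 / p) ^ 2],
    whose sum over primes is at most 2. *)
Lemma sum_exp_rank_le n (r : nat -> nat) s c h :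
  (forall p, r p <= s)%N -> (2 <= c)%N -> (s + c <= h)%N ->
  \sum_(p < n.+1 | (p : nat) \in primes n) (p%:R : R) ^+ r p / p%:R ^+ h <= 2 * 2 ^- c.
Proof.
move=> r_le c_ge2 h_ge.
have term p : prime p -> (p%:R : R) ^+ r p / p%:R ^+ h <= 2 ^- c * (2 / p%:R) ^+ 2.
  move=> p_pr; have p_gt0 : 0 < p%:R :> R by rewrite ltr0n prime_gt0.
  have r_h : (c + r p <= h)%N by have := r_le p; lia.
  have q_ge0 : 0 <= 2 / p%:R :> R by rewrite divr_ge0 ?ler0n.
  have q_le1 : 2 / p%:R <= 1 :> R by rewrite ler_pdivrMr // mul1r ler_nat prime_gt1.
  apply: le_trans (expr_div_le _ r_h) _; first by rewrite ler1n prime_gt0.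
  have -> : p%:R ^- c = 2 ^- c * (2 / p%:R) ^+ c :> R.
    by rewrite exprMn mulrA mulVf ?mul1r ?exprVn // expf_neq0.
  by rewrite ler_wpM2l ?invr_ge0 ?exprn_ge0 // ler_wiXn2l.
apply: (@le_trans _ _ (\sum_(p < n.+1 | prime p) 2 ^- c * (2 / p%:R) ^+ 2)).
  rewrite [X in X <= _]big_mkcond [X in _ <= X]big_mkcond; apply: ler_sum => p _.
  rewrite mem_primes; case: (boolP (prime p)) => //= p_pr.
  by case: ifP => _; [exact: term | rewrite mulr_ge0 ?sqr_ge0 ?invr_ge0 ?exprn_ge0].
rewrite -mulr_sumr mulrC ler_wpM2r ?invr_ge0 ?exprn_ge0 //.
exact: sum_inv_prime_sqr_le.
Qed.

(** The hypothesis makes the logarithm positive, so its integer ceiling is a natural number and can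
    serve as an exponent. *)
Lemma ceil_log2 (x : R) : 1 < x ->
  exists2 c : nat, Num.ceil (ln x / ln 2) = c%:Z & x <= 2 ^+ c.
Proof.
move=> x_gt1; have ln2_gt0 : 0 < ln 2 :> R by rewrite ln_gt0 ?ltr1n.
have : 0 <= Num.ceil (ln x / ln 2).
  by rewrite ceil_ge0 (lt_le_trans (ltrN10 _)) // ltW // divr_gt0 // ln_gt0.
case E: (Num.ceil _) => [c|//] _; exists c => //.
have x_gt0 : 0 < x by lra.
rewrite -ler_ln ?posrE ?exprn_gt0 // lnXn // -[_ *+ c]mulr_natl -ler_pdivrMr //.
by have := ceil_ge (ln x / ln 2); rewrite E.
Qed.
End Numeric.

(** * The two sufficient iteration counts *)

Theorem theorem1 (R : realType) (k : nat) (N : 'I_k -> nat)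
  (HN : forall j, exists p e, [/\ prime p, (0 < e)%N & N j = (p ^ e)%N])
  (K : {set grp N}) (HK : is_subgroup K)
  (f : grp N -> grp N) (Hf : forall x y, f x = f y <-> subG x y \in K)
  (eps : R) (Heps0 : 0 < eps) (Heps1 : eps < 1) (h : nat) :
  ((rankG N)%:R + (Num.ceil (ln (2 / eps) / ln 2))%:~R <= (h%:R : R)
   \/ (len_of_order #|grp N|)%:R - (len_of_order #|K|)%:R
        + (Num.ceil (ln (1 / eps) / ln 2))%:~R <= (h%:R : R)) ->
  1 - eps <= prob_success R f h K.
Proof.
have Npos j : (0 < N j)%N.
  by have [p [e [p_pr _ ->]]] := HN j; rewrite expn_gt0 prime_gt0.
pose KG : {group tupgroup Npos} := Group (is_subgroup_group_set Npos HK).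
pose G : {group tupgroup Npos} := [set: tupgroup Npos]%G.
pose Q : {group coset_of KG} := (G / KG)%G.
have cQQ : abelian Q by rewrite quotient_abelian ?tupgroup_abelian.
have := @prob_failure_le R k N Npos KG f Hf h; rewrite -[gval (_ / _)%G]/(gval Q).
move=> /le_trans/(_ (sum_order_prime_le cQQ R h)); set S := \sum_(p < _ | _) _ => fail_le.
suff S_le : (rankG N)%:R + (Num.ceil (ln (2 / eps) / ln 2))%:~R <= (h%:R : R) \/
  (len_of_order #|grp N|)%:R - (len_of_order #|K|)%:R
    + (Num.ceil (ln (1 / eps) / ln 2))%:~R <= (h%:R : R) -> S <= eps.
  by move=> /S_le; move: fail_le => /=; lra.
have x_gt1 : 1 < 1 / eps by rewrite ltr_pdivlMr // mul1r.
have exp2V_le (x : R) c : 0 < x -> x / eps <= 2 ^+ c -> x * 2 ^- c <= eps.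
  move=> x_gt0; rewrite ler_pdivrMr // => x_le.
  by rewrite ler_pdivrMr ?exprn_gt0 // mulrC.
case=> [h_ge|h_ge].
  have [|c Ec c_ge] := @ceil_log2 R (2 / eps); first by lra.
  (* Since [eps < 1], [2 / eps] exceeds 2, hence so does [2 ^+ c]. *)
  have c_ge2 : (2 <= c)%N.
    have : 2 ^+ 1 < 2 ^+ c :> R by apply: lt_le_trans c_ge; lra.
    by rewrite ltr_eXn2l ?ltr1n.
  apply: le_trans (exp2V_le 2 c _ c_ge) => //.
  apply: (@sum_exp_rank_le R #|Q| (fun p => 'r_p(Q)%g) (rankG N)) c_ge2 _ => [p|].
    apply: leq_trans (p_rank_le_rank p Q) _.
    exact: leq_trans (quotient_rank_abelian KG (tupgroup_abelian G)) (rank_le_rankG Npos).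
  by move: h_ge; rewrite Ec -natrD ler_nat.
have [c Ec c_ge] := ceil_log2 x_gt1.
apply: le_trans (exp2V_le 1 c _ c_ge) => //; rewrite mul1r.
apply: (@sum_exp_len_le R #|Q| (fun p => 'r_p(Q)%g)) => [p|]; first exact: p_rank_le_logn.
have nKG : G \subset 'N(KG)%g by apply: normal_norm; apply: tupgroup_normal.
(* By Lagrange and additivity of the length, the length of [Q] is the difference in the hypothesis
   on [h]. *)
have card_G : #|grp N| = (#|Q| * #|KG|)%N.
  have -> : #|Q| = #|G : KG|%g := card_quotient nKG.
  by rewrite mulnC (Lagrange (finset.subsetT KG)) finset.cardsT.
move: h_ge; rewrite Ec card_G len_of_orderM ?cardG_gt0 //.
by rewrite natrD addrK -natrD ler_nat.
Qed.
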